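(* Let $n\ge 1$ and let $T=(\tau_1,\dots,\tau_n)$ be a list of thresholds with $1\ge\tau_1\ge\dots\ge\tau_n>0$ such that $\mathtt{RBF}(\mathcal I,T)$ outputs a $T$-MMS allocation for every ordered, $n$-normalized fair division instance $\mathcal I$ with $n$ agents. Then the ex-ante MMS guarantee $\frac1n\sum_{i=1}^n\tau_i$ and the ex-post MMS guarantee $\tau_n$, obtained by running $\mathtt{RBF}$ with thresholds $T$ and cyclically random priority ranks, satisfy $$\frac1n\sum_{i=1}^n\tau_i\le 3\ln\left(\frac43\right)+\frac1{2n}\qquad\text{and}\qquad \tau_n\le\frac{3n}{4n-2}=\frac34+\frac{3}{8n-4}.$$
   Context: Write $[t]=\{1,\dots,t\}$. A fair division instance consists of agents $[n]$, goods $[m]$, and additive valuations $v_i:2^{[m]}\to\mathbb{R}_{\ge0}$. $\mathrm{MMS}_i$ is the maximum, over partitions $(P_1,\dots,P_n)$ of $[m]$, of $\min_j v_i(P_j)$. The instance is ordered if $v_i(1)\ge v_i(2)\ge\dots\ge v_i(m)$ for all $i$, and $n$-normalized if for every agent $i$ there is a partition $(P_1,\dots,P_n)$ of $[m]$ with $v_i(P_j)=1$ for all $j$ (so $\mathrm{MMS}_i=1$). Agent $i$ has priority rank $i$. A (possibly partial) allocation $A=(A_1,\dots,A_n)$ is $T$-MMS if $v_i(A_i)\ge\tau_i\mathrm{MMS}_i$ for all $i$. If an algorithm always outputs a $T$-MMS allocation, then shifting the priority ranks cyclically by a uniformly random amount makes every agent's rank uniform on $[n]$, which guarantees ex-post $\tau_n$-MMS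 (every realized allocation gives each agent at least $\tau_n\mathrm{MMS}_i$) and ex-ante $\left(\frac1n\sum_i\tau_i\right)$-MMS (each agent's expected value is at least that multiple of $\mathrm{MMS}_i$). For a finite set $S$ of positive integers, $\#(S,j)$ is the $j$-th smallest element of $S$, and $\#(S,J)=\{\#(S,j): j\in J,\ j\le|S|\}$. Algorithm $\mathtt{RBF}(\mathcal I,T)$. Input: an ordered, $n$-normalized instance with agents $[n]$, goods $[m]$, and thresholds $1\ge\tau_1\ge\dots\ge\tau_n>0$. Phase 1 (reductions). Start with $N=[n]$, $M=[m]$. While $N\ne\emptyset$ and $M\neq\emptyset$: let $S_1=\#(M,\{1\})$, $S_2=\#(M,\{|N|,|N|+1\})$, $S_3=\#(M,\{2|N|-1,2|N|,2|N|+1\})$, $S_4=\#(M,\{1,2|N|+1\})$. Find the lexicographically smallest pair $(k,i)\in[4]\times N$ with $v_i(S_k)\ge\tau_i$. If it exists, give $S_k$ to agent $i$ (a type-$k$ reduction) and replace $N$ by $N\setminus\{i\}$ and $M$ by $M\setminus S_k$; otherwise end phase 1. Phase 2 (bag filling). With the remaining $N$ and $M$ (it always holds that $|M|\ge2|N|$), form bags $B_j=\{\#(M,j),\#(M,2|N|+1-j)\}$ for $j=1,\dots,|N|$. While some agent is unsatisfied: if some unsatisfied agent $i$ has $v_i(B_k)\ge\tau_i$ for some unassigned bag $B_k$, take the smallest such $i$, give her such a bag, and mark her satisfied; otherwise, if there are unassigned goods outside the bags, add the one with smallest index (most valuable) to an arbitrary unassigned bag; otherwise, allocate the remaining bags arbitrarily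 to the unsatisfied agents and stop. Arbitrary choices are resolved by any fixed rule. *)

(* Defs.v *)
From mathcomp Require Import all_boot all_order all_algebra.
From mathcomp Require Import reals.

Set Implicit Arguments.
Unset Strict Implicit.
Unset Printing Implicit Defensive.

Import Order.TTheory GRing.Theory Num.Theory.
Local Open Scope ring_scope.

(* Agents are 'I_n and goods are 'I_m: the agent (good) called k in [n] ([m])
   on paper is the ordinal of value k - 1, so both orders are preserved.
   An additive valuation profile is given by its values on single goods. *)
Definition value (R : realType) (n m : nat) (v : 'I_n -> 'I_m -> R)
    (i : 'I_n) (S : {set 'I_m}) : R :=
  \sum_(g in S) v i g.

Definition nonnegative (R : realType) (n m : nat) (v : 'I_n -> 'I_m -> R) : Prop :=
  forall i g, 0 <= v i g.

(* A partition (P_1, ..., P_n) of the goods, with possibly empty parts, is the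
   map sending each good to the index of its part. *)
Definition part (n m : nat) (P : {ffun 'I_m -> 'I_n}) (j : 'I_n) : {set 'I_m} :=
  [set g | P g == j].

(* For a nonnegative v and n >= 1 the default elements 0 and v_i([m]) of the
   iterated max and min do not affect the result. *)
Definition MMS (R : realType) (n m : nat) (v : 'I_n -> 'I_m -> R) (i : 'I_n) : R :=
  \big[Num.max/0]_(P : {ffun 'I_m -> 'I_n})
    \big[Num.min/value v i [set: 'I_m]]_(j < n) value v i (part P j).

Definition ordered (R : realType) (n m : nat) (v : 'I_n -> 'I_m -> R) : Prop :=
  forall (i : 'I_n) (g h : 'I_m), (g <= h)%N -> v i h <= v i g.

Definition normalized (R : realType) (n m : nat) (v : 'I_n -> 'I_m -> R) : Prop :=
  forall i : 'I_n, exists P : {ffun 'I_m -> 'I_n},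
    forall j : 'I_n, value v i (part P j) = 1.

Definition allocation (n m : nat) := {ffun 'I_n -> {set 'I_m}}.

Definition T_MMS (R : realType) (n m : nat) (v : 'I_n -> 'I_m -> R)
    (tau : 'I_n -> R) (A : allocation n m) : Prop :=
  forall i : 'I_n, tau i * MMS v i <= value v i (A i).

Definition thresholds (R : realType) (n : nat) (tau : 'I_n -> R) : Prop :=
  (forall i : 'I_n, 0 < tau i <= 1) /\
  (forall i j : 'I_n, (i <= j)%N -> tau j <= tau i).

(* nths S J = #(S, J), with J a list of positions counted from 1: the good g of
   S is the j-th smallest one iff exactly j elements of S are at most g. *)
Definition nths (m : nat) (S : {set 'I_m}) (J : seq nat) : {set 'I_m} :=
  [set g in S | #|[set h in S | (h <= g)%N]| \in J].

Definition give (n m : nat) (A : allocation n m) (i : 'I_n) (S : {set 'I_m}) :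
    allocation n m :=
  [ffun a => if a == i then S else A a].

Record state1 (n m : nat) := State1 {
  agents : {set 'I_n};
  goods : {set 'I_m};
  given1 : allocation n m }.

Definition reduction (n m : nat) (N : {set 'I_n}) (M : {set 'I_m}) (k : nat) :
    {set 'I_m} :=
  match k with
  | 1 => nths M [:: 1%N]
  | 2 => nths M [:: #|N|; #|N|.+1]
  | 3 => nths M [:: (2 * #|N| - 1)%N; (2 * #|N|)%N; (2 * #|N|).+1]
  | 4 => nths M [:: 1%N; (2 * #|N|).+1]
  | _ => set0
  end.

(* The list of all pairs (k, i) is in lexicographic order, since enum lists
   ordinals increasingly; its first admissible element is the smallest one. *)
Definition step1 (R : realType) (n m : nat) (v : 'I_n -> 'I_m -> R)
    (tau : 'I_n -> R) (s : state1 n m) : state1 n m :=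
  let: State1 N M A := s in
  if (N == set0) || (M == set0) then s else
  let pairs := [seq (k, i) | k <- iota 1 4, i <- enum N] in
  match ohead [seq p <- pairs | tau p.2 <= value v p.2 (reduction N M p.1)] with
  | Some (k, i) =>
      State1 (N :\ i) (M :\: reduction N M k) (give A i (reduction N M k))
  | None => s
  end.

(* A step that changes the state removes an agent, so after n steps phase 1 has
   ended. *)
Definition phase1 (R : realType) (n m : nat) (v : 'I_n -> 'I_m -> R)
    (tau : 'I_n -> R) : state1 n m :=
  iter n (step1 v tau) (State1 setT setT [ffun=> set0]).

(* The bags in play at the start of phase 2 are those with an index < |N|. *)
Record state2 (n m : nat) := State2 {
  unsatisfied : {set 'I_n};
  unassigned : {set 'I_n};
  bag : {ffun 'I_n -> {set 'I_m}};
  outside : {set 'I_m};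
  given2 : allocation n m }.

(* A fixed rule for the arbitrary choices, all of which select a bag from a
   nonempty set of bags; it may depend on the instance and on the whole current
   state. *)
Record rule (R : realType) (n : nat) := Rule {
  choice : forall m : nat,
    ('I_n -> 'I_m -> R) -> state2 n m -> {set 'I_n} -> 'I_n;
  choiceP : forall (m : nat) (v : 'I_n -> 'I_m -> R) (s : state2 n m)
    (C : {set 'I_n}), C != set0 -> choice v s C \in C }.

(* Bag j of the code is the bag B_(j+1) = {#(M, j+1), #(M, 2|N|+1-(j+1))}. *)
Definition start2 (n m : nat) (s : state1 n m) : state2 n m :=
  let: State1 N M A := s in
  let B := [ffun j : 'I_n => nths M [:: j.+1; (2 * #|N| - j)%N]] in
  let K := [set j : 'I_n | (j < #|N|)%N] in
  State2 N K B (M :\: \bigcup_(j in K) B j) A.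

(* The final distribution of the remaining bags is performed one agent at a
   time: once no unsatisfied agent accepts an unassigned bag and no good is left
   outside, this remains so after every such assignment. *)
Definition step2 (R : realType) (n m : nat) (rho : rule R n)
    (v : 'I_n -> 'I_m -> R) (tau : 'I_n -> R) (s : state2 n m) : state2 n m :=
  let: State2 U K B G A := s in
  let accepted i := [set k in K | tau i <= value v i (B k)] in
  let assign i k := State2 (U :\ i) (K :\ k) B G (give A i (B k)) in
  match ohead [seq i <- enum U | accepted i != set0] with
  | Some i => assign i (choice rho v s (accepted i))
  | None =>
    match ohead (enum U), ohead (enum G) with
    | None, _ => s
    | Some _, Some g =>
        let k := choice rho v s K in
        State2 U K [ffun j => if j == k then g |: B j else B j] (G :\ g) A
    | Some i, None => assign i (choice rho v s K)
    end
  end.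

(* Every step satisfies an agent or consumes an outside good until no agent is
   unsatisfied, so n + m steps suffice. *)
Definition phase2 (R : realType) (n m : nat) (rho : rule R n)
    (v : 'I_n -> 'I_m -> R) (tau : 'I_n -> R) (s : state2 n m) : state2 n m :=
  iter (n + m) (step2 rho v tau) s.

Definition RBF (R : realType) (n m : nat) (rho : rule R n)
    (v : 'I_n -> 'I_m -> R) (tau : 'I_n -> R) : allocation n m :=
  given2 (phase2 rho v tau (start2 (phase1 v tau))).

(* Priority ranks shifted cyclically by s: agent i has rank i + s modulo n.  RBF
   is run on the profile indexed by ranks, and agent i receives the bundle of
   her rank. *)
Definition RBF_shift (R : realType) (n m : nat) (rho : rule R n)
    (v : 'I_n -> 'I_m -> R) (tau : 'I_n -> R) (s : 'I_n) : allocation n m :=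
  let A := RBF rho (fun r => v (iter s (@ord_pred n) r)) tau in
  [ffun i => A (iter s (@ordS n) i)].

(* The guarantees of a random allocation that is uniform over A s, s < n. *)
Definition ex_ante_MMS (R : realType) (n m : nat) (v : 'I_n -> 'I_m -> R)
    (alpha : R) (A : 'I_n -> allocation n m) : Prop :=
  forall i : 'I_n, alpha * MMS v i <= (\sum_(s < n) value v i (A s i)) / n%:R.

Definition ex_post_MMS (R : realType) (n m : nat) (v : 'I_n -> 'I_m -> R)
    (alpha : R) (A : 'I_n -> allocation n m) : Prop :=
  forall s i : 'I_n, alpha * MMS v i <= value v i (A s i).

Definition last_agent (n : nat) (hn : (0 < n)%N) : 'I_n :=
  Ordinal (etrans (ltn_predL n) hn).

(* Main.v *)
(** For each rank [c >= 2] a single instance shows that [tau_c <= 3n / (3n + c - 2)].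
    The agents of rank at most [c] share a valuation which, in units of
    [1 / (3n + c - 2)], gives the first [2n] goods the values
    [2n-1, 2n-1, 2n-2, 2n-2, ..., n, n], the next [c - 1] goods the value [n],
    and the others the value [0].  The agents of lower rank value a long enough
    initial segment of the goods uniformly, so finely that one good is too
    little for them and two goods suffice: each of them leaves by a type-2
    reduction with the two middle goods among the first [2n], worth [3n - 1]
    units.  Nothing worth more than [3n] units is then offered to the top [c]
    agents in phase 1, and in phase 2 they face [c] bags worth [3n - 1] units but
    only [c - 1] goods to fill them, so that one of them receives at most [3n]
    units, while her MMS is [3n + c - 2] units.
    The ex-ante bound sums these bounds (with [tau_1 <= 1]) by means of
    [1 / x <= ln x - ln (x - 1)]. *)

Require Import Defs.
From mathcomp Require Import all_boot all_order all_algebra.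
From mathcomp Require Import reals exp.
From mathcomp Require Import zify ring lra.
Set Implicit Arguments.
Unset Strict Implicit.
Unset Printing Implicit Defensive.
Import Order.TTheory GRing.Theory Num.Theory.
Local Open Scope ring_scope.

(** * Sums over sets of goods, and bounds on MMS *)

Lemma sum_over_seq (R : realType) (m : nat) (f : nat -> R) (S : {set 'I_m})
    (s : seq nat) :
  uniq s -> {in s, forall x, (x < m)%N} ->
  (forall g : 'I_m, nat_of_ord g \in s -> g \in S) ->
  (forall g : 'I_m, g \in S -> nat_of_ord g \notin s -> f g = 0) ->
  \sum_(g in S) f g = \sum_(x <- s) f x.
Proof.
move=> us sm sS S0.
transitivity (\sum_(0 <= x < m | x \in s) f x).
  rewrite big_mkord big_mkcond [RHS]big_mkcond; apply: eq_bigr => g _ /=.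
  case: ifPn => [gS|gS]; case: ifPn => // gs; first exact: S0.
  by rewrite (sS _ gs) in gS.
rewrite -big_filter; apply: perm_big; apply: uniq_perm => //.
  by rewrite filter_uniq // iota_uniq.
move=> x; rewrite mem_filter mem_index_iota /=.
by case: (boolP (x \in s)) => //= /sm ->.
Qed.

Lemma card_ord_lt (m k : nat) :
  (k <= m)%N -> #|[set h : 'I_m | (h < k)%N]| = k.
Proof.
move=> km; rewrite -sum1_card.
rewrite (eq_bigl (fun h : 'I_m => (h < k)%N)); last by move=> h; rewrite inE.
by rewrite (big_ord_narrow km) /= sum_nat_const card_ord muln1.
Qed.

Lemma MMS_ge0 (R : realType) (n m : nat) (v : 'I_n -> 'I_m -> R) (i : 'I_n) :
  0 <= MMS v i.
Proof. exact: bigmax_ge_id. Qed.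

Lemma MMS_ge1 (R : realType) (n m : nat) (v : 'I_n -> 'I_m -> R) (i : 'I_n) :
  nonnegative v -> normalized v -> 1 <= MMS v i.
Proof.
move=> v0 /(_ i)[P P1]; apply: (bigmax_sup P) => //; apply/bigmin_geP.
split => [|j _]; last by rewrite P1.
(* The default of the minimum, the value of all goods, is at least that of a single part. *)
rewrite -(P1 i) /value [leRHS](big_setID (part P i)) /= setTI.
by rewrite lerDl sumr_ge0.
Qed.

(** * An invariant of phase 2 *)

(* A state from which some agent of C ends with value at most t: either she has
   already left, or there are fewer goods of F left than agents to serve, while
   every bag without such a good is worth at most t. *)
Definition doomed (R : realType) (n m : nat) (v : 'I_n -> 'I_m -> R) (t : R)
    (C : {set 'I_n}) (F : {set 'I_m}) (s : state2 n m) : Prop :=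
  let: State2 U K B G A := s in
  (exists a, [/\ a \in C, a \notin U & value v a (A a) <= t]) \/
  [/\ U \subset C, {in U, forall a, A a = set0} & #|K| = #|U|] /\
  [/\ (\sum_(k in K) #|B k :&: F| + #|G :&: F| < #|U|)%N,
      {in K & C, forall k a, B k :&: F = set0 -> value v a (B k) <= t}
    & {in G & C, forall g a, g \notin F -> v a g = 0}].

(** If bag [k] misses [F], then [i] is the poor agent sought. Otherwise the bag uses up a good of
    [F], so the number of such goods drops at least as much as the number of agents to serve. *)
Lemma doomed_assign (R : realType) (n m : nat) (v : 'I_n -> 'I_m -> R) (t : R)
    (C U K : {set 'I_n}) (F : {set 'I_m}) B G A i k :
  i \in U -> (#|K| = #|U| -> k \in K) ->
  doomed v t C F (State2 U K B G A) ->
  doomed v t C F (State2 (U :\ i) (K :\ k) B G (give A i (B k))).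
Proof.
move=> iU kK [[a [aC aU aA]]|[[UC UA KU] [sF Bt G0]]]; rewrite /doomed.
  left; exists a; split => //; first by rewrite inE negb_and aU orbT.
  by rewrite /give ffunE; case: eqP aU => // ->; rewrite iU.
have {}kK := kK KU.
have iC : i \in C by apply: (subsetP UC).
have [BF|BF] := eqVneq (B k :&: F) set0.
  left; exists i; split => //; first by rewrite !inE eqxx.
  by rewrite /give ffunE eqxx Bt.
right; split; split.
- by apply: subset_trans UC; apply: subsetDl.
- move=> a; rewrite !inE => /andP[ai aU].
  by rewrite /give ffunE (negPf ai) UA.
- by move: KU; rewrite (cardsD1 k K) kK (cardsD1 i U) iU => -[].
- move: sF; rewrite (cardsD1 i U) iU (big_setD1 k) //=.
  move: BF; rewrite -card_gt0 => BF sF.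
  by rewrite -(ltn_add2l 1); apply: leq_ltn_trans sF; rewrite addnA !leq_add2r.
- by move=> k' a /setD1P[_ k'K] aC; apply: Bt.
- by [].
Qed.

(** Moving a good of [F] into a bag keeps the count of such goods; moving any other good adds no
    value for the agents of [C]. *)
Lemma doomed_step2 (R : realType) (n m : nat) (rho : rule R n)
    (v : 'I_n -> 'I_m -> R) (tau : 'I_n -> R) (t : R)
    (C : {set 'I_n}) (F : {set 'I_m}) (s : state2 n m) :
  doomed v t C F s -> doomed v t C F (step2 rho v tau s).
Proof.
case: s => U K B G A D; rewrite /step2.
case E: (ohead [seq _ <- enum U | _]) => [i|].
  have [iU acc]: i \in U /\ [set k in K | tau i <= value v i (B k)] != set0.
    have : i \in [seq i <- enum U | [set k in K | tau i <= value v i (B k)] != set0].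
      by case: [seq _ <- _ | _] E => //= x s' [->]; rewrite mem_head.
    by rewrite mem_filter mem_enum => /andP[].
  apply: doomed_assign => // _.
  by have := choiceP rho v (State2 U K B G A) acc; rewrite inE => /andP[].
case EU: (ohead (enum U)) => [i|] //.
have iU : i \in U.
  by rewrite -mem_enum; case: (enum U) EU => //= x s' [->]; rewrite mem_head.
have Kn0 : #|K| = #|U| -> K != set0.
  by move=> KU; rewrite -card_gt0 KU card_gt0; apply/set0Pn; exists i.
case EG: (ohead (enum G)) => [g|]; last first.
  by apply: doomed_assign => // /Kn0; apply: choiceP.
have gG : g \in G.
  by rewrite -mem_enum; case: (enum G) EG => //= x s' [->]; rewrite mem_head.
set k := choice _ _ _ _.
case: D => [?|[[UC UA KU] [sF Bt G0]]]; first by left.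
have kK : k \in K by apply/choiceP/Kn0.
right; split; split => //.
- apply: leq_ltn_trans sF.
  rewrite (big_setD1 k) //= [X in (_ <= X + _)%N](big_setD1 k) //=.
  rewrite ffunE eqxx.
  rewrite (eq_bigr (fun j => #|B j :&: F|)); last first.
    by move=> j; rewrite !inE ffunE => /andP[/negPf -> _].
  have : (#|(g |: B k) :&: F| <= (g \in F) + #|B k :&: F|)%N.
    rewrite setIUl; apply: leq_trans (leq_card_setU _ _) _.
    rewrite leq_add2r; case: (boolP (g \in F)) => gF.
      by rewrite (leq_trans (subset_leq_card (subsetIl _ _))) // cards1.
    rewrite leqn0 cards_eq0; apply/eqP/setP => x; rewrite !inE.
    by case: eqP => // ->; apply/negbTE.
  have : (#|G :&: F| = (g \in F) + #|(G :\ g) :&: F|)%N.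
    by rewrite (cardsD1 g (G :&: F)) inE gG /= setIDAC.
  by move=> -> h; rewrite addnA leq_add2r addnAC leq_add2r addnC.
- move=> j a jK aC; rewrite ffunE; case: eqP => [-> BF|_]; last exact: Bt.
  have gF : g \notin F.
    by apply/negP => gF; have := in_set0 g; rewrite -BF !inE eqxx gF.
  have BF' : B k :&: F = set0.
    by apply/eqP; rewrite -subset0 -BF setSI // subsetUr.
  case: (boolP (g \in B k)) => gB.
    by rewrite (setUidPr _) ?sub1set // Bt.
  by rewrite /value big_setU1 //= (G0 g a) // add0r Bt.
- by move=> x a /setD1P[_ xG]; apply: G0.
Qed.

Lemma doomed_phase2 (R : realType) (n m : nat) (rho : rule R n)
    (v : 'I_n -> 'I_m -> R) (tau : 'I_n -> R) (t : R)
    (C : {set 'I_n}) (F : {set 'I_m}) (s : state2 n m) :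
  0 <= t -> doomed v t C F s ->
  exists2 a, a \in C & value v a (given2 (phase2 rho v tau s) a) <= t.
Proof.
move=> t0 D.
have : doomed v t C F (phase2 rho v tau s).
  by rewrite /phase2; elim: (n + m)%N => //= l; apply: doomed_step2.
case: (phase2 _ _ _ _) => U K B G A [[a [aC _ aA]]|]; first by exists a.
move=> [[UC UA _] [sF _ _]].
have /card_gt0P[a aU] : (0 < #|U|)%N by lia.
by exists a; [apply: (subsetP UC) | rewrite /= UA // /value big_set0].
Qed.

(** * The hard instance *)

(* Values of the goods to the top c agents; goods are counted from 0. *)
Definition level (n c x : nat) : nat :=
  (if x < 2 * n then 2 * n - 1 - x./2
   else if x < 2 * n + c - 1 then n else 0)%N.

(** Dividing by [3n + c - 2], the number of units in each part, makes the MMS of a top agent 1. For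
    the others, any [K a] of the first [n * K a] goods are worth 1. *)
Definition grade (R : realType) (n c : nat) (K : 'I_n -> nat) (a : 'I_n)
    (x : nat) : R :=
  if (a < c)%N then (level n c x)%:R / (3 * n + c - 2)%:R
  else if (x < n * K a)%N then (K a)%:R^-1 else 0.

Definition hard (R : realType) (n m c : nat) (K : 'I_n -> nat)
    (a : 'I_n) (g : 'I_m) : R := grade R c K a g.
Arguments hard R {n m} c K a g.

Lemma hard_ge0 (R : realType) (n m c : nat) (K : 'I_n -> nat) :
  nonnegative (@hard R n m c K).
Proof.
move=> a g; rewrite /hard /grade; case: ifP => _; first by rewrite divr_ge0.
by case: ifP => // _; rewrite invr_ge0.
Qed.

Lemma hard_ordered (R : realType) (n m c : nat) (K : 'I_n -> nat) :
  (c <= n)%N -> ordered (@hard R n m c K).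
Proof.
move=> cn a g h gh; rewrite /hard /grade; case: ifP => _.
  rewrite ler_wpM2r ?invr_ge0 // ler_nat /level.
  by do ![case: ifPn => ?]; lia.
by do 2?[case: ifPn => ?]; rewrite ?invr_ge0 //; lia.
Qed.

(* Good 2k goes to part k.  Good 2k+1 goes to the part j such that goods 2j and
   2k+1 are worth 1 together if k <= n - c, and 1 together with one of the c - 1
   filling goods otherwise. *)
Definition top_part (n c x : nat) : nat :=
  (let k := x./2 in
   if x < 2 * n then
     if ~~ odd x then k else if k <= n - c then n - c - k else 2 * n - c - k
   else if x < 2 * n + c - 1 then x - n - c + 1 else 0)%N.

Lemma hard_normalized (R : realType) (n m c : nat) (K : 'I_n -> nat) :
  (1 < c <= n)%N -> (2 * n + c <= m)%N ->
  (forall a, 0 < K a)%N -> (forall a, n * K a <= m)%N ->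
  normalized (@hard R n m c K).
Proof.
move=> /andP[c1 cn] mc K0 mK a; have n0 : (0 < n)%N by lia.
pose p x := (if (a < c)%N then top_part n c x else x %/ K a)%N.
exists [ffun g : 'I_m => insubd (Ordinal n0) (p g)] => j.
rewrite /value /hard /grade.
have jn := ltn_ord j; have K0a := K0 a; have mKa := mK a.
have inpart (g : 'I_m) : (p g < n)%N ->
    (g \in part [ffun g : 'I_m => insubd (Ordinal n0) (p g)] j) = (p g == j).
  by move=> pg; rewrite !inE ffunE -val_eqE val_insubd pg.
move: @p inpart; case: (a < c)%N => p inpart.
  have pn x : (p x < n)%N by rewrite /p /top_part; do ?case: ifPn; lia.
  (* The goods of part [j]. The first two are worth [3n + c - 2] units together in the first case,
     and [2n + c - 2] in the second, where a filling good worth [n] completes them. *)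
  set s := (if j <= n - c then [:: 2 * j; (2 * (n - c - j)).+1]
    else [:: 2 * j; (2 * (2 * n - c - j)).+1; 2 * n + j - (n - c + 1)])%N.
  rewrite (@sum_over_seq _ _ (fun x => (level n c x)%:R / (3 * n + c - 2)%:R)
     _ s).
  - have -> : \sum_(x <- s) (level n c x)%:R / (3 * n + c - 2)%:R =
        (\sum_(x <- s) level n c x)%N%:R / (3 * n + c - 2)%:R :> R.
      by rewrite natr_sum mulr_suml.
    have -> : (\sum_(x <- s) level n c x = 3 * n + c - 2)%N.
      rewrite /s /level; case: ifPn => jc; rewrite !big_cons big_nil;
        do ![case: ifPn => ?]; lia.
    by rewrite divff // pnatr_eq0; lia.
  - by rewrite /s; case: ifPn => jc /=; rewrite !inE; lia.
  - by move=> x; rewrite /s; case: ifPn => jc /=; rewrite !inE; lia.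
  - move=> g; rewrite inpart // /s /p /top_part.
    by do ![case: ifPn => ?]; rewrite !inE; lia.
  - move=> g; rewrite inpart // => pg gs.
    suff -> : level n c g = 0%N by rewrite mul0r.
    move: pg gs; rewrite /s /p /top_part /level.
    by do ![case: ifPn => ?]; rewrite !inE; lia.
(* For the other agents the parts are blocks of [K a] consecutive goods. *)
set f := (fun x => if (x < n * K a)%N then (K a)%:R^-1 else 0 : R).
rewrite (@sum_over_seq _ _ f _ (iota (j * K a) (K a))).
- rewrite (eq_big_seq (fun _ => (K a)%:R^-1)); last first.
    by move=> x; rewrite mem_iota /f => /andP[x1 x2]; rewrite ifT //; nia.
  by rewrite big_const_seq count_predT size_iota iter_addr_0 -[LHS]mulr_natr mulVf //
    pnatr_eq0; lia.
- exact: iota_uniq.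
- by move=> x; rewrite mem_iota => /andP[x1 x2]; nia.
- move=> g; rewrite mem_iota => /andP[g1 g2].
  have pj : p g = j by rewrite /p; nia.
  by rewrite inpart pj.
- move=> g gj; rewrite mem_iota /f; case: ifP => // gK /negP[].
  have pgn : (p g < n)%N by rewrite /p ltn_divLR // mulnC.
  by move: gj; rewrite inpart // /p => /eqP <-; lia.
Qed.

(** * Bundles offered after [r] type-2 reductions *)

(* The goods left after r type-2 reductions. *)
Definition remaining (n m r : nat) : {set 'I_m} :=
  [set g : 'I_m | (g < n - r)%N || (n + r <= g)%N].
Arguments remaining n {m} r.

Lemma remaining_rank (n m r : nat) (g : 'I_m) :
  (r <= n)%N -> (2 * n <= m)%N -> g \in remaining n r ->
  #|[set h : 'I_m in remaining n r | (h <= g)%N]| =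
    (if g < n - r then g.+1 else g.+1 - 2 * r)%N.
Proof.
move=> rn nm; rewrite inE => gr; have gm := ltn_ord g.
pose L k := [set h : 'I_m | (h < k)%N].
have cL k : (k <= m)%N -> #|L k| = k by apply: card_ord_lt.
case: ifPn => gn.
  rewrite -[RHS]cL //; apply: eq_card => h; rewrite !inE; lia.
(* The initial segment up to [g] without the gap of [2r] removed goods. *)
have -> : [set h : 'I_m in remaining n r | (h <= g)%N] =
    L g.+1 :\: (L (n + r)%N :\: L (n - r)%N).
  by apply/setP => h; rewrite !inE; lia.
have s1 : L (n - r)%N \subset L (n + r)%N.
  by apply/subsetP => h; rewrite !inE; lia.
have s2 : L (n + r)%N \subset L g.+1.
  by apply/subsetP => h; rewrite !inE; lia.
rewrite cardsD (setIidPr _); last exact: subset_trans (subsetDl _ _) s2.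
by rewrite cardsD (setIidPr s1) !cL; lia.
Qed.

(* The good of rank j (counted from 1) among the remaining ones. *)
Definition slot (n r j : nat) : nat :=
  (if j <= n - r then j - 1 else j - 1 + 2 * r)%N.

Lemma nths_remaining (n m r : nat) (J : seq nat) :
  (r <= n)%N -> (2 * n <= m)%N -> all (leq 1) J ->
  nths (@remaining n m r) J = [set g : 'I_m | nat_of_ord g \in map (slot n r) J].
Proof.
move=> rn nm /allP J0; apply/setP => g; rewrite !in_set.
apply/andP/mapP => [[gr gJ]|[j jJ gj]].
  eexists; first exact: gJ.
  rewrite remaining_rank ?inE // /slot.
  by case: (ltnP g (n - r)) gr => gn gr; case: ifPn; lia.
have j0 := J0 _ jJ; have gr : g \in remaining n r.
  by move: gj; rewrite inE /slot; case: ifP; lia.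
split; first by move: gr; rewrite inE.
rewrite remaining_rank //.
suff -> : (if (g < n - r)%N then g.+1 else (g.+1 - 2 * r)%N) = j by [].
by move: gj; rewrite /slot; case: (ltnP g (n - r)) => ?; case: ifPn; lia.
Qed.

(** Type 2 takes the two goods bordering the gap and so widens it; the positions used by the other
    types do not depend on [r]. *)
Definition reduction_seq (n r k : nat) : seq nat :=
  let q := (n - r)%N in
  match k with
  | 1 => [:: 0]%N
  | 2 => [:: q - 1; n + r]%N
  | 3 => [:: 2 * n - 2; 2 * n - 1; 2 * n]%N
  | 4 => [:: 0; 2 * n]%N
  | _ => [::]
  end.

(** With [q = n - r > 1] the ranks [2q - 1], [2q], [2q + 1] exceed [q], so these goods lie beyond
    the gap. *)
Lemma reduction_remaining (n m r k : nat) (N : {set 'I_n}) :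
  #|N| = (n - r)%N -> (1 < n - r)%N -> (2 * n <= m)%N ->
  reduction N (remaining n r) k =
    [set g : 'I_m | nat_of_ord g \in reduction_seq n r k].
Proof.
move=> NE r1 nm; rewrite /reduction NE.
have rn : (r <= n)%N by lia.
case: k => [|[|[|[|[|k]]]]]; last 1 first.
all: try by apply/setP => g; rewrite !inE.
all: rewrite nths_remaining //=; try by rewrite ?andbT; lia.
all: apply/setP => g; rewrite !inE /slot.
all: by do ![case: ifPn => ?]; lia.
Qed.

Section Values.
Variables (R : realType) (n m c : nat) (K : 'I_n -> nat).
Hypotheses (c1 : (1 < c)%N) (cn : (c <= n)%N) (mc : (2 * n + c <= m)%N).

Let v : 'I_n -> 'I_m -> R := hard R c K.

Lemma value_hard (a : 'I_n) (s : seq nat) :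
  uniq s -> all (fun x => x < m)%N s ->
  value v a [set g : 'I_m | nat_of_ord g \in s] = \sum_(x <- s) grade R c K a x.
Proof.
move=> us /allP sm; rewrite /value /v /hard.
apply: (sum_over_seq (f := grade R c K a)) => // g; first by rewrite inE.
by rewrite inE => ->.
Qed.

(** The worth of [3n] units. For [c = n] it is the ex-post bound [3n / (4n - 2)]. *)
Definition top_share : R := (3 * n)%:R / (3 * n + c - 2)%:R.

Lemma value_hard_top (a : 'I_n) (s : seq nat) :
  (a < c)%N -> uniq s -> all (fun x => x < m)%N s ->
  (\sum_(x <- s) level n c x <= 3 * n)%N ->
  value v a [set g : 'I_m | nat_of_ord g \in s] <= top_share.
Proof.
move=> ac us sm sL; rewrite value_hard // /grade ac -mulr_suml -natr_sum.
by rewrite ler_wpM2r ?invr_ge0 // ler_nat.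
Qed.

(** In units, types 1 to 4 offer [2n - 1], [3n - 1], [3n] and [3n - 1]. For type 2 the two positions
    sum to [2n - 1], so their halves, rounded down, sum to [n - 1] whatever [r] is. *)
Lemma reduction_top (a : 'I_n) (r k : nat) (N : {set 'I_n}) :
  #|N| = (n - r)%N -> (1 < n - r)%N -> (0 < k <= 4)%N -> (a < c)%N ->
  value v a (reduction N (remaining n r) k) <= top_share.
Proof.
move=> NE r1 k4 ac; rewrite reduction_remaining //; last lia.
apply: value_hard_top => //; case: k k4 => [|[|[|[|[|k]]]]] //= _.
all: rewrite ?inE ?andbT ?big_cons ?big_nil //; try lia.
all: by rewrite /level; do ![case: ifPn => ?]; lia.
Qed.

Lemma reduction_bottom1 (a : 'I_n) (r : nat) (N : {set 'I_n}) :
  #|N| = (n - r)%N -> (1 < n - r)%N -> (c <= a)%N ->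
  value v a (reduction N (remaining n r) 1) <= (K a)%:R^-1.
Proof.
move=> NE r1 ac; rewrite reduction_remaining //; last lia.
rewrite value_hard //=; last by rewrite andbT; lia.
rewrite big_seq1 /grade ltnNge ac /=.
by case: ifP => // _; rewrite invr_ge0.
Qed.

(** Both goods are among the first [2n], all of which count for the agent once [K a] is at least
    2. *)
Lemma reduction_bottom2 (a : 'I_n) (r : nat) (N : {set 'I_n}) :
  #|N| = (n - r)%N -> (1 < n - r)%N -> (c <= a)%N -> (1 < K a)%N ->
  value v a (reduction N (remaining n r) 2) = 2 / (K a)%:R.
Proof.
move=> NE r1 ac K1; rewrite reduction_remaining //; last lia.
rewrite value_hard //=; last 2 first.
- by rewrite inE andbT; lia.
- by rewrite andbT; lia.
rewrite !big_cons big_nil addr0 /grade ltnNge ac /= !ifT; last 2 first.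
- nia.
- nia.
by rewrite mulr_natl mulr2n.
Qed.

End Values.

(** * The run of the algorithm on the hard instance *)

Local Arguments reduction : simpl never.

Section Run.
Variables (R : realType) (n m c : nat) (K : 'I_n -> nat) (tau : 'I_n -> R).
Hypotheses (c1 : (1 < c)%N) (cn : (c <= n)%N) (mc : (2 * n + c <= m)%N).
Hypothesis (tau_top : forall a : 'I_n, (a < c)%N -> top_share R n c < tau a).
Hypothesis (tau_bottom : forall a : 'I_n, (c <= a)%N ->
  (K a)%:R^-1 < tau a <= 2 / (K a)%:R).
Hypothesis (K1 : forall a, (1 < K a)%N).

Let v : 'I_n -> 'I_m -> R := hard R c K.

(** The invariant of phase 1. It records how many agents have left but not which ones, beyond that
    the top [c] stay. *)
Definition middle_removed (r : nat) (s : state1 n m) : Prop :=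
  [/\ goods s = remaining n r, #|agents s| = (n - r)%N,
      forall a : 'I_n, (a < c)%N -> a \in agents s
    & {in agents s, forall a, given1 s a = set0}].

Lemma middle_removed_start : middle_removed 0 (State1 setT setT [ffun=> set0]).
Proof.
split => //=; last by move=> a _; rewrite ffunE.
- by apply/setP => g; rewrite !inE; lia.
- by rewrite cardsT card_ord subn0.
- by move=> a _; rewrite inE.
Qed.

(** Nobody accepts a single good, and since more than [c] agents remain, one outside the top [c]
    accepts the two goods at the gap. Hence the first admissible pair has type 2, and its agent is
    not in the top [c], who refuse every bundle. *)
Lemma middle_removed_step (r : nat) (s : state1 n m) :
  (r < n - c)%N -> middle_removed r s -> middle_removed r.+1 (step1 v tau s).
Proof.
case: s => N M A rc [/= ME NE topN A0]; rewrite ME /step1.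
have r1 : (1 < n - r)%N by lia.
rewrite ifF; last first.
  apply/negbTE; rewrite negb_or -!card_gt0 NE; apply/andP; split; first by lia.
  apply/card_gt0P; have m0 : (0 < m)%N by lia.
  by exists (Ordinal m0); rewrite inE /=; lia.
set P := (fun p : nat * 'I_n => _ <= _); rewrite /=.
have lt1 a : value v a (reduction N (remaining n r) 1) < tau a.
  case: (ltnP a c) => ac.
    by apply: le_lt_trans _ (tau_top ac); apply: reduction_top.
  have /andP[Kt _] := tau_bottom ac.
  by apply: le_lt_trans _ Kt; apply: reduction_bottom1.
have nil1 : [seq p <- [seq (1%N, i) | i <- enum N] | P p] = [::].
  apply/eqP; rewrite -(negbK (_ == _)) -has_filter; apply/hasPn => p.
  by case/mapP => a _ ->; apply: contraL (lt1 a); rewrite -leNgt.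
have has2 : has P [seq (2%N, i) | i <- enum N].
  have [a aN ac] : exists2 a, a \in N & (c <= a)%N.
    apply/exists_inP; apply: contraTT rc; rewrite negb_exists_in => /forall_inP H.
    rewrite -leqNgt leq_subCl -NE -[leqRHS](@card_ord_lt n) //.
    by apply/subset_leq_card/subsetP => a /H; rewrite inE; lia.
  apply/hasP; exists (2%N, a); first by rewrite map_f // mem_enum.
  by rewrite /P /= reduction_bottom2 //; case/andP: (tau_bottom ac).
rewrite filter_cat nil1 filter_cat /=.
case E : [seq p <- [seq (2%N, i) | i <- enum N] | P p] => [|p l] /=.
  by rewrite has_filter E in has2.
have : p \in [seq p <- [seq (2%N, i) | i <- enum N] | P p] by rewrite E mem_head.
rewrite mem_filter => /andP[Pp /mapP[a]]; rewrite mem_enum => aN pE.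
move: Pp; rewrite pE /P /= => va.
have ac : (c <= a)%N.
  rewrite leqNgt; apply/negP => ac.
  have : value v a (reduction N (remaining n r) 2) < tau a.
    by apply: le_lt_trans _ (tau_top ac); apply: reduction_top.
  by rewrite ltNge va.
split => /=.
- rewrite reduction_remaining //; last lia.
  by apply/setP => g; rewrite !inE; lia.
- by move: NE; rewrite (cardsD1 a) aN add1n subnS => <-.
- move=> b bc; rewrite !inE topN // andbT.
  by apply: contraTneq bc => ->; rewrite -leqNgt.
- by move=> b; rewrite !inE => /andP[/negPf ba bN]; rewrite /give ffunE ba A0.
Qed.

Lemma middle_removed_stuck (s : state1 n m) :
  middle_removed (n - c) s -> step1 v tau s = s.
Proof.
case: s => N M A [/= ME NE topN A0]; rewrite ME /step1; case: ifP => // _.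
have NC : N = [set a : 'I_n | (a < c)%N].
  apply/esym/eqP; rewrite eqEcard; apply/andP; split.
    by apply/subsetP => a; rewrite inE; apply: topN.
  by rewrite NE card_ord_lt //; lia.
set l := [seq p <- _ | _]; suff -> : l = [::] by [].
apply/eqP; rewrite -(negbK (_ == _)) -has_filter; apply/hasPn => p.
rewrite -[_ ++ _]/[seq (k, i) | k <- iota 1 4, i <- enum N].
case/allpairsPdep => k [a] [kI]; rewrite mem_enum NC inE => ac ->.
rewrite -ltNge; apply: le_lt_trans _ (tau_top ac).
apply: (@reduction_top R n m c K c1 cn mc a (n - c)) => //; try lia.
  by rewrite -NC.
by rewrite mem_iota in kI.
Qed.

Lemma middle_removed_phase1 : middle_removed (n - c) (phase1 v tau).
Proof.
(* The first [n - c] steps remove all agents outside the top [c]; the last [c] steps change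
   nothing. *)
rewrite /phase1 (_ : iter n _ _ = iter c (step1 v tau) (iter (n - c) (step1 v tau)
  (State1 setT setT [ffun=> set0]))); last by rewrite -iterD subnKC.
have H r : (r <= n - c)%N -> middle_removed r
    (iter r (step1 v tau) (State1 setT setT [ffun=> set0])).
  elim: r => [|r IH] rc; first exact: middle_removed_start.
  by rewrite iterS; apply: middle_removed_step => //; apply: IH; lia.
have := H _ (leqnn _); set s := iter (n - c) _ _ => Hs.
suff E k : iter k (step1 v tau) s = s by rewrite E.
by elim: k => //= k ->; apply: middle_removed_stuck.
Qed.

Lemma hard_fails (rho : rule R n) :
  exists2 a : 'I_n, (a < c)%N & value v a (RBF rho v tau a) <= top_share R n c.
Proof.
have := middle_removed_phase1; rewrite /RBF.
case: (phase1 v tau) => N M A [/= ME NE topN A0].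
pose C := [set a : 'I_n | (a < c)%N].
(* The [c - 1] filling goods, one fewer than the agents left. *)
pose F := [set g : 'I_m | (2 * n <= g < 2 * n + c - 1)%N].
have Nc : #|N| = c by rewrite NE subKn.
have NC : N = C.
  apply/esym/eqP; rewrite eqEcard Nc card_ord_lt // leqnn andbT.
  by apply/subsetP => a; rewrite inE; apply: topN.
suff D : doomed v (top_share R n c) C F (start2 (State1 N M A)).
  have t0 : 0 <= top_share R n c by rewrite divr_ge0.
  have [a aC aA] := doomed_phase2 rho tau t0 D.
  by exists a => //; rewrite inE in aC.
(* The two positions sum to [2n - 1], so each bag is worth [3n - 1] units. *)
have B_E (j : 'I_n) : (j < c)%N ->
    nths M [:: j.+1; (2 * c - j)%N] =
    [set g : 'I_m | nat_of_ord g \in [:: nat_of_ord j; 2 * n - 1 - j]%N].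
  move=> jc; rewrite ME nths_remaining /=; try lia.
  by apply/setP => g; rewrite !inE /slot; do ![case: ifPn => ?]; lia.
have BF (j : 'I_n) : (j < c)%N -> nths M [:: j.+1; (2 * c - j)%N] :&: F = set0.
  by move=> jc; rewrite B_E //; apply/setP => g; rewrite !inE; lia.
rewrite /start2 Nc; right; split; split.
- by rewrite NC.
- exact: A0.
- by rewrite Nc card_ord_lt.
- rewrite big1 ?add0n ?Nc; last first.
    by move=> j; rewrite inE ffunE => jc; rewrite BF // cards0.
  apply: (@leq_ltn_trans #|F|); first exact/subset_leq_card/subsetIr.
  have -> : F = [set g : 'I_m | (g < 2 * n + c - 1)%N]
      :\: [set g : 'I_m | (g < 2 * n)%N].
    by apply/setP => g; rewrite !inE; lia.
  rewrite cardsD (setIidPr _); last by apply/subsetP => g; rewrite !inE; lia.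
  by rewrite !card_ord_lt; lia.
- move=> j a; rewrite !inE ffunE => jc ac _.
  rewrite B_E //; apply: value_hard_top => //=.
  + by rewrite inE andbT; lia.
  + by rewrite andbT; lia.
  + by rewrite !big_cons big_nil /level; do ![case: ifPn => ?]; lia.
- move=> g a; rewrite inE => /andP[gB gM] aC gF.
  rewrite inE in aC; rewrite /v /hard /grade aC.
  suff -> : level n c g = 0%N by rewrite mul0r.
  (* A remaining good below [2n] is in bag [g] or in bag [2n - 1 - g], so an outside good that is
     not a filling good is worth 0. *)
  have g2 : (2 * n <= g)%N.
    rewrite leqNgt; apply: contra gB => g2; apply/bigcupP.
    have jn : ((if g < c then g : nat else 2 * n - 1 - g) < n)%N.
      by move: gM; rewrite ME inE; case: ifP; lia.
    exists (Ordinal jn).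
      by rewrite inE /=; move: gM; rewrite ME inE; case: ifP; lia.
    rewrite ffunE B_E /=; last by move: gM; rewrite ME inE; case: ifP; lia.
    by rewrite !inE; case: ifP; lia.
  by move: gF; rewrite inE /level; do ![case: ifPn => ?]; lia.
Qed.

End Run.

(** * Logarithmic estimates and the bound on each threshold *)

Lemma inv_le_lnB (R : realType) (x : R) : 1 < x -> x^-1 <= ln x - ln (x - 1).
Proof.
move=> x1; have x0 : 0 < x by lra.
have xB : 0 < x - 1 by lra.
have i1 : x^-1 < 1 by rewrite invf_lt1.
have : ln (1 + - x^-1) <= - x^-1 by apply: le_ln1Dx; lra.
have -> : 1 + - x^-1 = (x - 1) / x by field; lra.
by rewrite ln_div ?posrE //; lra.
Qed.

(** [t k] stands for the threshold of rank [k + 1]. The first two terms are bounded by 1 each; from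
    rank 3 on, [inv_le_lnB] makes the bounds telescope. *)
Lemma sum_thresholds_le (R : realType) (n : nat) (t : nat -> R) (c : nat) :
  (1 < n)%N -> (forall k, t k <= 1) ->
  (forall k, (0 < k < n)%N -> t k <= top_share R n k.+1) ->
  (1 < c <= n)%N ->
  (\sum_(0 <= k < c) t k) / n%:R <=
    2 / n%:R + 3 * (ln (3 * n + c - 2)%:R - ln (3 * n)%:R).
Proof.
move=> n1 t1 ht; have n0 : 0 < n%:R :> R by rewrite ltr0n; lia.
elim: c => // c IH /andP[c1 cn].
have [->|c2] := eqVneq c 1%N.
  rewrite big_nat_recr //= big_nat1 addnK subrr mulr0 addr0.
  rewrite ler_wpM2r ?invr_ge0 ?ler0n //.
  by rewrite -[2]/(1 + 1) lerD.
rewrite big_nat_recr //= mulrDl.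
have {}IH := IH (_ : (1 < c <= n)%N); have {}IH := IH ltac:(lia).
have tc : t c <= top_share R n c.+1 by apply: ht; lia.
have N1 : (1 < 3 * n + c.+1 - 2)%N by lia.
have : (3 * n + c.+1 - 2)%:R^-1 <=
    ln (3 * n + c.+1 - 2)%:R - ln (3 * n + c - 2)%:R :> R.
  have -> : (3 * n + c - 2)%:R = (3 * n + c.+1 - 2)%:R - 1 :> R.
    by rewrite -[1]/(1%:R) -natrB; [congr (_%:R); lia | lia].
  by apply: inv_le_lnB; rewrite ltr1n.
have : t c / n%:R <= 3 * (3 * n + c.+1 - 2)%:R^-1.
  rewrite ler_pdivrMr // (le_trans tc) // /top_share natrM.
  by rewrite mulrAC.
lra.
Qed.

(** [(4n - 2) / (3n)] is [4/3] times [1 - 1/(2n)]; the logarithm of the last factor is at most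
    [-1/(2n)], and [2/n - 3/(2n) = 1/(2n)]. *)
Lemma log_bound (R : realType) (n : nat) : (0 < n)%N ->
  2 / n%:R + 3 * (ln (3 * n + n - 2)%:R - ln (3 * n)%:R) <=
    3 * ln (4 / 3) + 1 / (2 * n%:R) :> R.
Proof.
move=> n1; have n0 : 1 <= n%:R :> R by rewrite ler1n.
have -> : (3 * n + n - 2)%:R = (4 / 3 * (1 + - (2 * n%:R)^-1)) * (3 * n)%:R :> R.
  rewrite natrB ?natrD ?natrM; last lia.
  by field; lra.
have i1 : (2 * n%:R)^-1 <= 2^-1 :> R by rewrite lef_pV2 ?posrE; lra.
have h : ln (1 + - (2 * n%:R)^-1) <= - (2 * n%:R)^-1 :> R.
  by apply: le_ln1Dx; lra.
by rewrite !lnM ?posrE ?mulr_gt0 ?ltr0n //; (lra || lia).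
Qed.

(** Otherwise the hard instance with [c = i + 1] leaves an agent of rank at most [c] below her
    threshold, although her MMS is at least 1. *)
Lemma threshold_le (R : realType) (n : nat) (tau : 'I_n -> R) (rho : rule R n)
    (htau : thresholds tau)
    (hRBF : forall (m : nat) (v : 'I_n -> 'I_m -> R),
        nonnegative v -> ordered v -> normalized v ->
        T_MMS v tau (RBF rho v tau)) (i : 'I_n) :
  (0 < i)%N -> tau i <= top_share R n i.+1.
Proof.
move=> i0; have [tau01 tau_mono] := htau; have := ltn_ord i.
rewrite leNgt => i_n; apply/negP => ti; set c := i.+1 in i_n ti.
have tau_gt0 a : 0 < tau a by case/andP: (tau01 a).
(* The least integer above [1 / tau a]: it is at most [1 / tau a + 1], hence at most [2 / tau a]. *)
pose K a := (Num.trunc (tau a)^-1).+1.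
have u1 a : 1 <= (tau a)^-1 by rewrite invf_ge1 //; case/andP: (tau01 a).
have K1 a : (1 < K a)%N by rewrite ltnS truncn_gt0.
have tauK a : (K a)%:R^-1 < tau a <= 2 / (K a)%:R.
  have K0 : 0 < (K a)%:R :> R by rewrite ltr0n.
  have t0 := tau_gt0 a.
  rewrite -[X in _ < X <= _]invrK ltf_pV2 ?posrE ?invr_gt0 // truncnS_gt /=.
  rewrite ler_pdivlMr // -[X in X * _]invrK ler_pdivrMl ?invr_gt0 // /K -[leLHS]natr1.
  have /andP[+ _] := truncn_itv (le_trans ler01 (u1 a)).
  have := u1 a; lra.
pose m := (2 * n + c + n * \max_a K a)%N.
have mK a : (n * K a <= m)%N.
  by rewrite (leq_trans _ (leq_addl _ _)) // leq_mul2l leq_bigmax orbT.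
have mc : (2 * n + c <= m)%N by apply: leq_addr.
have top (a : 'I_n) : (a < c)%N -> top_share R n c < tau a.
  by move=> ac; apply: lt_le_trans ti (tau_mono _ _ _).
have [a ac] := hard_fails (c := c) (m := m) i0 i_n mc top
  (fun a _ => tauK a) K1 rho.
apply/negP; rewrite -ltNge.
have v0 := @hard_ge0 R n m c K.
have vn : normalized (@hard R n m c K).
  by apply: hard_normalized => //; apply/andP.
apply: lt_le_trans (top _ ac) (le_trans _ (hRBF _ _ v0 _ vn a)).
  by rewrite ler_peMr ?MMS_ge1 // ltW.
exact: hard_ordered.
Qed.

(** * Cyclic shifts and the final bounds *)

Lemma iter_ordS (n s : nat) (i : 'I_n) :
  iter s (@ordS n) i = ((i + s) %% n)%N :> nat.
Proof.
elim: s => [|s IH]; first by rewrite addn0 modn_small.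
by rewrite iterS /= IH -addn1 modnDml addn1 addnS.
Qed.

(** This makes the rank of each agent uniform under a uniform shift. *)
Lemma iter_ordS_inj (n : nat) (i : 'I_n) :
  injective (fun s : 'I_n => iter s (@ordS n) i).
Proof.
move=> s t /(congr1 val) /=; rewrite !iter_ordS => /eqP.
by rewrite eqn_modDl !modn_small // => /eqP /val_inj.
Qed.

Lemma RBF_shift_share (R : realType) (n m : nat) (tau : 'I_n -> R)
    (rho : rule R n) (v : 'I_n -> 'I_m -> R)
    (hRBF : forall (m : nat) (v : 'I_n -> 'I_m -> R),
        nonnegative v -> ordered v -> normalized v ->
        T_MMS v tau (RBF rho v tau)) (s i : 'I_n) :
  nonnegative v -> ordered v -> normalized v ->
  tau (iter s (@ordS n) i) * MMS v i <= value v i (RBF_shift rho v tau s i).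
Proof.
move=> v0 vo vn; rewrite /RBF_shift ffunE.
pose w (r : 'I_n) := v (iter s (@ord_pred n) r).
(* Shifting back from the rank of [i] recovers agent [i]. *)
have wE : w (iter s (@ordS n) i) = v i.
  rewrite /w; congr (v _).
  by elim: (nat_of_ord s) => // k IH; rewrite iterSr iterS ordSK.
have := hRBF m w (fun _ => v0 _) (fun _ => vo _) (fun _ => vn _)
  (iter s (@ordS n) i).
by rewrite /MMS /value wE.
Qed.

Theorem theorem9 (R : realType) (n : nat) (hn : (0 < n)%N) (tau : 'I_n -> R)
    (rho : rule R n)
    (htau : thresholds tau)
    (hRBF : forall (m : nat) (v : 'I_n -> 'I_m -> R),
        nonnegative v -> ordered v -> normalized v ->
        T_MMS v tau (RBF rho v tau)) :
  let ex_ante := (\sum_(i < n) tau i) / n%:R in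
  let ex_post := tau (last_agent hn) in
  [/\ forall (m : nat) (v : 'I_n -> 'I_m -> R),
        nonnegative v -> ordered v -> normalized v ->
        ex_ante_MMS v ex_ante (RBF_shift rho v tau) /\
        ex_post_MMS v ex_post (RBF_shift rho v tau),
      ex_ante <= 3 * ln (4 / 3) + 1 / (2 * n%:R),
      ex_post <= 3 * n%:R / (4 * n%:R - 2)
    & 3 * n%:R / (4 * n%:R - 2) = 3 / 4 + 3 / (8 * n%:R - 4) :> R].
Proof.
move=> ex_ante ex_post; have [tau01 tau_mono] := htau.
have tau1 a : tau a <= 1 by case/andP: (tau01 a).
have n1 : 1 <= n%:R :> R by rewrite ler1n.
split; last by field; apply/andP; split; lra.
- move=> m v v0 vo vn; split.
    move=> i; rewrite /ex_ante mulrAC ler_wpM2r ?invr_ge0 ?ler0n //.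
    rewrite (reindex_inj (@iter_ordS_inj n i)) /= mulr_suml.
    by apply: ler_sum => s _; apply: RBF_shift_share.
  move=> s i; apply: le_trans (RBF_shift_share hRBF s i v0 vo vn).
  rewrite ler_wpM2r ?MMS_ge0 //; apply: tau_mono => /=.
  by rewrite -ltnS prednK.
- case: (ltnP 1 n) => n2; last first.
    have {}n2 : n = 1%N by lia.
    (* For [n = 1] it suffices that [ln (4/3) >= 1/4], as [3/4 + 1/2 >= 1]. *)
    have : ln (1 + - 4^-1) <= - 4^-1 :> R by apply: le_ln1Dx; lra.
    have -> : 1 + - 4^-1 = (4 / 3)^-1 :> R by lra.
    rewrite lnV ?posrE; last lra.
    have : ex_ante <= 1.
      rewrite /ex_ante ler_pdivrMr ?mul1r ?ltr0n //.
      by rewrite -[n in leRHS]card_ord -sum1_card natr_sum; apply: ler_sum.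
    have -> : n%:R = 1 :> R by rewrite n2.
    lra.
  apply: le_trans (log_bound R hn).
  pose t k := tau (insubd (Ordinal hn) k).
  have -> : ex_ante = (\sum_(0 <= k < n) t k) / n%:R.
    by rewrite /ex_ante big_mkord; congr (_ / _); apply: eq_bigr => a _; rewrite /t valKd.
  apply: sum_thresholds_le => //; last by rewrite n2 leqnn.
    by move=> k; apply: tau1.
  move=> k /andP[k0 kn].
  have -> : t k = tau (Ordinal kn) by congr tau; apply/val_inj; rewrite val_insubd kn.
  exact: (threshold_le htau hRBF (i := Ordinal kn)).
- case: (ltnP 1 n) => n2; last first.
    apply: (le_trans (tau1 _)).
    have -> : n%:R = 1 :> R by rewrite (_ : n = 1%N) //; lia.
    by rewrite ler_pdivlMr; lra.
  have last_n : (last_agent hn).+1 = n by apply: prednK.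
  (* The ex-post bound is the threshold bound for the last rank, [c = n]. *)
  have -> : 3 * n%:R / (4 * n%:R - 2) = top_share R n (last_agent hn).+1.
    rewrite last_n /top_share natrB ?natrD ?natrM; last lia.
    by congr (_ / _); ring.
  by apply: (threshold_le htau hRBF); rewrite -ltnS last_n.
Qed.
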